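(* Let $\Phi\subseteq\{I,O,U,\mathit{Self},Q_n,N_n\mid n\in\mathbb N\setminus\{0\}\}$. Let $\mathcal I$ and $\mathcal I'$ be fuzzy interpretations that are witnessed w.r.t. $\mathcal L^{\sim}_\Phi$, and let $x\in\Delta^{\mathcal I}$, $x'\in\Delta^{\mathcal I'}$ be strongly $\Phi$-bisimilar (there is a crisp $\Phi$-bisimulation $Z$ between $\mathcal I$ and $\mathcal I'$ with $Z(x,x')=1$). Then $C^{\mathcal I}(x)=C^{\mathcal I'}(x')$ for every concept $C$ of $\mathcal L^{\sim}_\Phi$.
   Context: Gödel operations on $[0,1]$: $p\otimes q=\min\{p,q\}$, $p\oplus q=\max\{p,q\}$, $\ominus p=1$ if $p=0$ and $0$ otherwise, $(p\Rightarrow q)=1$ if $p\le q$ and $q$ otherwise, $(p\Leftrightarrow q)=(p\Rightarrow q)\otimes(q\Rightarrow p)$. Fix pairwise disjoint sets $\mathsf{CN}$, $\mathsf{RN}$, $\mathsf{IN}$ of concept, role and individual names. A basic role w.r.t. $\Phi$ is $r\in\mathsf{RN}$, or $r^-$ when $I\in\Phi$. Roles and concepts of $\mathcal L^{\sim}_\Phi$: each $r\in\mathsf{RN}$ is a role; if $R,S$ are roles and $C$ a concept then $R\circ S$, $R\sqcup S$, $R^*$, $C?$ are roles; $R^-$ if $I\in\Phi$; $U$ if $U\in\Phi$; concepts: $p\in[0,1]$, $A\in\mathsf{CN}$, $C\sqcap D$, $C\to D$, $\neg C$, $C\sqcup D$, $\mathord{\sim}C$ (involutive negation), $\forall R.C$,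 $\exists R.C$; $\{a\}$ ($a\in\mathsf{IN}$) if $O\in\Phi$; $\exists r.\mathit{Self}$ if $\mathit{Self}\in\Phi$; ${\ge}n\,R.C$, ${<}n\,R.C$ for basic $R$ if $Q_n\in\Phi$; ${\ge}n\,R$, ${<}n\,R$ for basic $R$ if $N_n\in\Phi$. $\top$ is concept $1$. A fuzzy interpretation $\mathcal I$ has a nonempty domain $\Delta^{\mathcal I}$, $a^{\mathcal I}\in\Delta^{\mathcal I}$, $A^{\mathcal I}:\Delta^{\mathcal I}\to[0,1]$, $r^{\mathcal I}:(\Delta^{\mathcal I})^2\to[0,1]$, extended by: $U^{\mathcal I}\equiv1$; $(R^-)^{\mathcal I}(x,y)=R^{\mathcal I}(y,x)$; $(C?)^{\mathcal I}(x,y)=C^{\mathcal I}(x)$ if $x=y$, else $0$; $(R\circ S)^{\mathcal I}(x,y)=\sup_z R^{\mathcal I}(x,z)\otimes S^{\mathcal I}(z,y)$; $(R\sqcup S)^{\mathcal I}=R^{\mathcal I}\oplus S^{\mathcal I}$; $(R^* )^{\mathcal I}(x,y)=\sup\{\min(\{1\}\cup\{R^{\mathcal I}(x_i,x_{i+1})\mid i<n\})\mid n\ge0,x_0=x,x_n=y\}$; $p^{\mathcal I}(x)=p$; $\{a\}^{\mathcal I}(x)=1$ iff $x=a^{\mathcal I}$, else $0$; $(\neg C)^{\mathcal I}=\ominus C^{\mathcal I}$; $(\mathord{\sim}C)^{\mathcal I}(x)=1-C^{\mathcal I}(x)$; $\sqcap,\sqcup,\to$ pointwise by $\otimes,\oplus,\Rightarrow$;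 $(\exists r.\mathit{Self})^{\mathcal I}(x)=r^{\mathcal I}(x,x)$; $(\exists R.C)^{\mathcal I}(x)=\sup_y R^{\mathcal I}(x,y)\otimes C^{\mathcal I}(y)$; $(\forall R.C)^{\mathcal I}(x)=\inf_y(R^{\mathcal I}(x,y)\Rightarrow C^{\mathcal I}(y))$; $({\ge}n\,R.C)^{\mathcal I}(x)=\sup\{\min_i(R^{\mathcal I}(x,y_i)\otimes C^{\mathcal I}(y_i))\mid y_1..y_n$ pairwise distinct$\}$; $({<}n\,R.C)^{\mathcal I}(x)=\inf\{\min_i(R^{\mathcal I}(x,y_i)\otimes C^{\mathcal I}(y_i))\Rightarrow e\mid y_1..y_n\}$ with $e=1$ if some $y_j=y_k$ ($j<k$), else $0$; ${\ge}n\,R={\ge}n\,R.\top$, ${<}n\,R={<}n\,R.\top$. Witnessed w.r.t. $\mathcal L^{\sim}_\Phi$: for roles/concepts of $\mathcal L^{\sim}_\Phi$, every infinite set whose infimum (supremum) is taken above has a least (greatest) element. A crisp $\Phi$-bisimulation between $\mathcal I,\mathcal I'$ is $Z:\Delta^{\mathcal I}\times\Delta^{\mathcal I'}\to\{0,1\}$ such that, for all $x,x',A\in\mathsf{CN},a\in\mathsf{IN},r\in\mathsf{RN}$ and basic $R$: (i) $Z(x,x')\le(A^{\mathcal I}(x)\Leftrightarrow A^{\mathcal I'}(x'))$; (ii) $\forall y\exists y'$: $Z(x,x')\otimes R^{\mathcal I}(x,y)\le Z(y,y')\otimes R^{\mathcal I'}(x',y')$; (iii) $\forall y'\exists y$: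 $Z(x,x')\otimes R^{\mathcal I'}(x',y')\le Z(y,y')\otimes R^{\mathcal I}(x,y)$; (iv) if $O\in\Phi$: $Z(x,x')=0$ whenever exactly one of $x=a^{\mathcal I}$, $x'=a^{\mathcal I'}$ holds; (v) if $U\in\Phi$: $\forall y\exists y'$ $Z(x,x')\le Z(y,y')$ and $\forall y'\exists y$ $Z(x,x')\le Z(y,y')$; (vi) if $\mathit{Self}\in\Phi$: $Z(x,x')\le(r^{\mathcal I}(x,x)\Leftrightarrow r^{\mathcal I'}(x',x'))$; (vii) if $Q_n\in\Phi$: if $Z(x,x')>0$ and $y_1..y_n$ pairwise distinct with all $R^{\mathcal I}(x,y_j)>0$, there exist pairwise distinct $y'_1..y'_n$ such that for each $i$ some $j$ has $Z(x,x')\otimes\bigotimes_k R^{\mathcal I}(x,y_k)\le Z(y_j,y'_i)\otimes R^{\mathcal I'}(x',y'_i)$, and symmetrically (from pairwise distinct $y'_1..y'_n$ with $R^{\mathcal I'}(x',y'_j)>0$ obtain pairwise distinct $y_1..y_n$ such that for each $i$ some $j$ has $Z(x,x')\otimes\bigotimes_k R^{\mathcal I'}(x',y'_k)\le Z(y_i,y'_j)\otimes R^{\mathcal I}(x,y_i)$); (viii) if $N_n\in\Phi$: as (vii) with right-hand sides $R^{\mathcal I'}(x',y'_i)$ for all $i$, resp. $R^{\mathcal I}(x,y_i)$ for all $i$. *)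

(* Defs.v *)
From HB Require Import structures.
From mathcomp Require Import all_boot all_order all_algebra.
From mathcomp Require Import boolp classical_sets functions cardinality reals.

Set Implicit Arguments.
Unset Strict Implicit.
Unset Printing Implicit Defensive.

Import Order.TTheory GRing.Theory Num.Theory.

Local Open Scope classical_set_scope.
Local Open Scope ring_scope.

Section GodelOperations.
Variable R : realType.
Implicit Types p q : R.

Definition gimp p q : R := if p <= q then 1 else q.
Definition gneg p : R := if p == 0 then 1 else 0.
Definition giff p q : R := Num.min (gimp p q) (gimp q p).

End GodelOperations.

Notation gand := Num.min.
Notation gor := Num.max.
(* The empty conjunction is 1; since truth values are at most 1, this is the
   minimum of the family as soon as 0 < n. *)
Notation "\gand_ ( i < n ) F" := (\big[Num.min/1%R]_(i < n) F%R)
  (at level 36, F at level 36, i, n at level 50,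
   format "'[' \gand_ ( i  <  n ) '/  '  F ']'") : ring_scope.

Inductive feature : Type :=
  | FI | FO | FU | FSelf | FQ of nat | FN of nat.

Definition features : set feature :=
  [set f | match f with FQ n | FN n => (0 < n)%N | _ => True end].

(* The languages are intrinsically typed: a constructor that depends on a
   feature takes a proof that the feature belongs to [Phi].  The sets of
   concept, role and individual names are separate types, hence disjoint. *)
Section Syntax.
Variables (R : realType) (CN RN IN : Type) (Phi : set feature).

Inductive basic_role : Type :=
  | BName of RN
  | BInv of Phi FI & RN.

Inductive role : Type :=
  | RName of RN
  | RComp of role & role
  | RUnion of role & role
  | RStar of role
  | RTest of concept
  | RInv of Phi FI & role
  | RUniv of Phi FU
with concept : Type :=
  | CConst (p : R) of 0 <= p <= 1
  | CName of CN
  | CAnd of concept & concept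
  | CImp of concept & concept
  | CNeg of concept
  | COr of concept & concept
  | CInvol of concept
  | CAll of role & concept
  | CEx of role & concept
  | CNominal of Phi FO & IN
  | CSelf of Phi FSelf & RN
  | CAtLeast n of Phi (FQ n) & basic_role & concept
  | CLessThan n of Phi (FQ n) & basic_role & concept
  | CAtLeastU n of Phi (FN n) & basic_role
  | CLessThanU n of Phi (FN n) & basic_role.

End Syntax.

Record interp (R : realType) (CN RN IN : Type) := Interp {
  dom :> Type;
  dom_nonempty : inhabited dom;
  iname : IN -> dom;
  cname : CN -> dom -> R;
  rname : RN -> dom -> dom -> R;
  cname01 : forall A x, 0 <= cname A x <= 1;
  rname01 : forall r x y, 0 <= rname r x y <= 1
}.

(* The sets of truth values whose supremum or infimum gives the semantics of
   the corresponding constructors. *)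
Section ValueSets.
Variables (R : realType) (D : Type).
Implicit Types (f g : D -> D -> R) (c : D -> R) (x y : D) (n : nat).

Definition comp_values f g x y : set R :=
  [set gand (f x z) (g z y) | z in [set: D]].

Definition star_values f x y : set R :=
  [set v | exists (n : nat) (s : nat -> D),
     [/\ s 0%N = x, s n = y & v = \gand_(i < n) f (s i) (s i.+1)]].

Definition ex_values f c x : set R :=
  [set gand (f x y) (c y) | y in [set: D]].

Definition all_values f c x : set R :=
  [set gimp (f x y) (c y) | y in [set: D]].

Definition atleast_values n f c x : set R :=
  [set \gand_(i < n) gand (f x (y i)) (c (y i))
     | y in [set y : 'I_n -> D | injective y]].

Definition lessthan_values n f c x : set R :=
  [set gimp (\gand_(i < n) gand (f x (y i)) (c (y i)))
            (if `[< exists j k : 'I_n, (j < k)%N /\ y j = y k >] then 1 else 0)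
     | y in [set: 'I_n -> D]].

End ValueSets.

(* [sup set0 = 0], which is also the supremum of the empty set in [0, 1]; the
   sets below [inf] are never empty, the domain being nonempty.
   Unqualified number restrictions are the qualified ones with filler 1, and
   [fun=> 1] is the interpretation of the constant concept 1. *)
Section Semantics.
Variables (R : realType) (CN RN IN : Type) (Phi : set feature).
Variable I : interp R CN RN IN.

Definition bsem (B : basic_role RN Phi) (x y : I) : R :=
  match B with
  | BName r => rname r x y
  | BInv _ r => rname r y x
  end.

Fixpoint rsem (T : role R CN RN IN Phi) (x y : I) {struct T} : R :=
  match T with
  | RName r => rname r x y
  | RComp T1 T2 => sup (comp_values (rsem T1) (rsem T2) x y)
  | RUnion T1 T2 => gor (rsem T1 x y) (rsem T2 x y)
  | RStar T1 => sup (star_values (rsem T1) x y)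
  | RTest C => if `[< x = y >] then csem C x else 0
  | RInv _ T1 => rsem T1 y x
  | RUniv _ => 1
  end
with csem (C : concept R CN RN IN Phi) (x : I) {struct C} : R :=
  match C with
  | CConst p _ => p
  | CName A => cname A x
  | CAnd C1 C2 => gand (csem C1 x) (csem C2 x)
  | CImp C1 C2 => gimp (csem C1 x) (csem C2 x)
  | CNeg C1 => gneg (csem C1 x)
  | COr C1 C2 => gor (csem C1 x) (csem C2 x)
  | CInvol C1 => 1 - csem C1 x
  | CAll T C1 => inf (all_values (rsem T) (csem C1) x)
  | CEx T C1 => sup (ex_values (rsem T) (csem C1) x)
  | CNominal _ a => if `[< x = iname I a >] then 1 else 0
  | CSelf _ r => rname r x x
  | CAtLeast n _ B C1 => sup (atleast_values n (bsem B) (csem C1) x)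
  | CLessThan n _ B C1 => inf (lessthan_values n (bsem B) (csem C1) x)
  | CAtLeastU n _ B => sup (atleast_values n (bsem B) (fun=> 1) x)
  | CLessThanU n _ B => inf (lessthan_values n (bsem B) (fun=> 1) x)
  end.

End Semantics.

Section Witnessed.
Variables (R : realType) (CN RN IN : Type).

Definition sup_witnessed (V : set R) : Prop :=
  infinite_set V -> V `&` ubound V !=set0.

Definition inf_witnessed (V : set R) : Prop :=
  infinite_set V -> V `&` lbound V !=set0.

Record witnessed (Phi : set feature) (I : interp R CN RN IN) : Prop :=
Witnessed {
  wit_comp : forall (T1 T2 : role R CN RN IN Phi) (x y : I),
    sup_witnessed (comp_values (rsem T1) (rsem T2) x y);
  wit_star : forall (T : role R CN RN IN Phi) (x y : I),
    sup_witnessed (star_values (rsem T) x y);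
  wit_ex : forall (T : role R CN RN IN Phi) (C : concept R CN RN IN Phi)
      (x : I),
    sup_witnessed (ex_values (rsem T) (csem C) x);
  wit_all : forall (T : role R CN RN IN Phi) (C : concept R CN RN IN Phi)
      (x : I),
    inf_witnessed (all_values (rsem T) (csem C) x);
  wit_atleast : forall n, Phi (FQ n) ->
    forall (B : basic_role RN Phi) (C : concept R CN RN IN Phi) (x : I),
    sup_witnessed (atleast_values n (bsem B) (csem C) x);
  wit_lessthan : forall n, Phi (FQ n) ->
    forall (B : basic_role RN Phi) (C : concept R CN RN IN Phi) (x : I),
    inf_witnessed (lessthan_values n (bsem B) (csem C) x);
  wit_atleastU : forall n, Phi (FN n) ->
    forall (B : basic_role RN Phi) (x : I),
    sup_witnessed (atleast_values n (bsem B) (fun=> 1) x);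
  wit_lessthanU : forall n, Phi (FN n) ->
    forall (B : basic_role RN Phi) (x : I),
    inf_witnessed (lessthan_values n (bsem B) (fun=> 1) x)
}.

End Witnessed.

Section Bisimulation.
Variables (R : realType) (CN RN IN : Type) (Phi : set feature).
Variables I I' : interp R CN RN IN.

(* A crisp relation is boolean-valued; [(Z x x')%:R] is its value 0 or 1. *)
Record crisp_bisimulation (Z : I -> I' -> bool) : Prop := CrispBisimulation {
  bisim_cname : forall x x' (A : CN),
    (Z x x')%:R <= giff (cname A x) (cname A x');
  bisim_forth : forall x x' (B : basic_role RN Phi) (y : I),
    exists y' : I',
      gand (Z x x')%:R (bsem B x y) <= gand (Z y y')%:R (bsem B x' y');
  bisim_back : forall x x' (B : basic_role RN Phi) (y' : I'),
    exists y : I,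
      gand (Z x x')%:R (bsem B x' y') <= gand (Z y y')%:R (bsem B x y);
  bisim_nominal : Phi FO -> forall x x' (a : IN),
    (x = iname I a /\ x' <> iname I' a) \/
    (x <> iname I a /\ x' = iname I' a) ->
    Z x x' = false;
  bisim_univ_forth : Phi FU -> forall x x' (y : I),
    exists y' : I', (Z x x')%:R <= (Z y y')%:R :> R;
  bisim_univ_back : Phi FU -> forall x x' (y' : I'),
    exists y : I, (Z x x')%:R <= (Z y y')%:R :> R;
  bisim_self : Phi FSelf -> forall x x' (r : RN),
    (Z x x')%:R <= giff (rname r x x) (rname r x' x');
  bisim_Q_forth : forall n, Phi (FQ n) ->
    forall x x' (B : basic_role RN Phi) (y : 'I_n -> I),
    0 < (Z x x')%:R :> R -> injective y -> (forall j, 0 < bsem B x (y j)) ->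
    exists2 y' : 'I_n -> I', injective y' &
      forall i, exists j,
        gand (Z x x')%:R (\gand_(k < n) bsem B x (y k))
          <= gand (Z (y j) (y' i))%:R (bsem B x' (y' i));
  bisim_Q_back : forall n, Phi (FQ n) ->
    forall x x' (B : basic_role RN Phi) (y' : 'I_n -> I'),
    0 < (Z x x')%:R :> R -> injective y' ->
    (forall j, 0 < bsem B x' (y' j)) ->
    exists2 y : 'I_n -> I, injective y &
      forall i, exists j,
        gand (Z x x')%:R (\gand_(k < n) bsem B x' (y' k))
          <= gand (Z (y i) (y' j))%:R (bsem B x (y i));
  bisim_N_forth : forall n, Phi (FN n) ->
    forall x x' (B : basic_role RN Phi) (y : 'I_n -> I),
    0 < (Z x x')%:R :> R -> injective y -> (forall j, 0 < bsem B x (y j)) ->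
    exists2 y' : 'I_n -> I', injective y' &
      forall i,
        gand (Z x x')%:R (\gand_(k < n) bsem B x (y k)) <= bsem B x' (y' i);
  bisim_N_back : forall n, Phi (FN n) ->
    forall x x' (B : basic_role RN Phi) (y' : 'I_n -> I'),
    0 < (Z x x')%:R :> R -> injective y' ->
    (forall j, 0 < bsem B x' (y' j)) ->
    exists2 y : 'I_n -> I, injective y &
      forall i,
        gand (Z x x')%:R (\gand_(k < n) bsem B x' (y' k)) <= bsem B x (y i)
}.

Definition strongly_bisimilar (x : I) (x' : I') : Prop :=
  exists2 Z : I -> I' -> bool, crisp_bisimulation Z & Z x x' = true.

End Bisimulation.

(* Main.v *)
(* By mutual induction on roles and concepts: along a crisp bisimulation Z,
   concepts take equal values at related points, and every role R simulates
   itself, i.e. if Z x x' and R(x,y) > 0 then some y' satisfies Z y y' and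
   R(x,y) <= R(x',y').  Nothing is claimed when R(x,y) = 0, a value that never
   matters for a supremum or infimum.  Witnessedness makes the suprema defining
   the composition and the star attained, so that the simulation can be run
   along the witness.  For R^- the induction must also simulate the converse of
   every role as soon as I is in Phi.  As the converse of a bisimulation is a
   bisimulation, each equality follows from one inequality. *)
Require Import Defs.
From mathcomp Require Import all_boot all_order all_algebra.
From mathcomp Require Import boolp classical_sets functions cardinality reals.

Set Implicit Arguments.
Unset Strict Implicit.
Unset Printing Implicit Defensive.

Import Order.TTheory GRing.Theory Num.Theory.

Local Open Scope classical_set_scope.
Local Open Scope ring_scope.

(** * Suprema, infima and Gödel operations in [0, 1] *)

Section UnitInterval.
Variable R : realType.
Implicit Types (p q v : R) (V : set R).

Definition unit_interval : set R := [set v | 0 <= v <= 1].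

Lemma sup_unit V : V `<=` unit_interval -> 0 <= sup V <= 1.
Proof.
(* The empty set is included: its supremum is 0 by convention. *)
move=> V01; have [->|/set0P[v Vv]] := eqVneq V set0.
  by rewrite sup0 lexx ler01.
have V1 : ubound V 1 by move=> w /V01/andP[].
have /andP[v0 _] := V01 _ Vv; apply/andP; split.
  by apply: (le_trans v0); apply: ub_le_sup => //; exists 1.
by apply: ge_sup => //; exists v.
Qed.

Lemma le_sup_unit V v : V `<=` unit_interval -> V v -> v <= sup V.
Proof. by move=> V01 Vv; apply: ub_le_sup => //; exists 1 => w /V01/andP[]. Qed.

Lemma ge_inf_unit V v : V `<=` unit_interval -> V v -> inf V <= v.
Proof. by move=> V01 Vv; apply: ge_inf => //; exists 0 => w /V01/andP[]. Qed.

Lemma inf_unit V : V !=set0 -> V `<=` unit_interval -> 0 <= inf V <= 1.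
Proof.
move=> [v Vv] V01; have /andP[_ v1] := V01 _ Vv; apply/andP; split.
  by apply: lb_le_inf; [exists v | move=> w /V01/andP[]].
exact: le_trans (ge_inf_unit V01 Vv) v1.
Qed.

Lemma finite_set_greatest V : finite_set V -> V !=set0 -> V `&` ubound V !=set0.
Proof.
move=> /finite_seqP[s ->] [v0 /= sv0].
case: (arg_maxP (fun i : seq_sub s => ssval i) (isT : xpredT (SeqSub sv0))).
move=> m _ mP; exists (ssval m); split=> /=; first exact: ssvalP.
by move=> w /= sw; apply: (mP (SeqSub sw)).
Qed.

(** Witnessedness speaks of infinite sets only, but a nonempty finite set has a greatest element
    anyway. Positivity rules out the empty set, whose supremum 0 is not a member. *)
Lemma sup_witnessed_attained V : sup_witnessed V -> 0 < sup V -> V (sup V).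
Proof.
move=> wV sup_gt0.
have V0 : V !=set0.
  by apply/set0P/eqP => V0; rewrite V0 sup0 ltxx in sup_gt0.
have [m [Vm ubm]] : V `&` ubound V !=set0.
  by have [/finite_set_greatest|/wV] := pselect (finite_set V); [exact|].
suff -> : sup V = m by [].
by apply/le_anti; rewrite ge_sup //= ub_le_sup //; exists m.
Qed.

Lemma gimp_unit p q : 0 <= q <= 1 -> 0 <= gimp p q <= 1.
Proof. by rewrite /gimp; case: ifP => // _ _; rewrite ler01 lexx. Qed.

Lemma min_unit p q : 0 <= p <= 1 -> 0 <= q <= 1 -> 0 <= gand p q <= 1.
Proof.
by move=> /andP[p0 p1] /andP[q0 q1]; rewrite le_min p0 q0 ge_min p1.
Qed.

Lemma max_unit p q : 0 <= p <= 1 -> 0 <= q <= 1 -> 0 <= gor p q <= 1.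
Proof.
by move=> /andP[p0 p1] /andP[q0 q1]; rewrite le_max p0 ge_max p1 q1.
Qed.

Lemma bool_unit (b : bool) : 0 <= (if b then 1 else 0 : R) <= 1.
Proof. by case: b; rewrite ?lexx ?ler01. Qed.

(** The iterated minimum starts from 1, whence the extra condition [v <= 1], the only one left when
    [n] is 0. *)
Lemma le_gandP n (F : 'I_n -> R) v :
  v <= \gand_(i < n) F i <-> v <= 1 /\ forall i, v <= F i.
Proof.
split=> [/bigmin_geP[v1 vF]|[v1 vF]]; first by split=> // i; apply: vF.
by apply/bigmin_geP; split.
Qed.

Lemma gand_le_gand n (F G : 'I_n -> R) :
  (forall i, exists j, F j <= G i) -> \gand_(i < n) F i <= \gand_(i < n) G i.
Proof.
move=> FG; have /le_gandP[le1 leF] := lexx (\gand_(i < n) F i).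
by apply/le_gandP; split=> // i; have [j /(le_trans (leF j))] := FG i.
Qed.

Lemma gand_unit n (F : 'I_n -> R) :
  (forall i, 0 <= F i) -> 0 <= \gand_(i < n) F i <= 1.
Proof.
move=> F0; apply/andP; split; first exact/le_gandP.
by have /le_gandP[] := lexx (\gand_(i < n) F i).
Qed.

(** A crisp value above a positive bound can only be 1. This is how the relatedness of successors is
    extracted from the inequalities of the bisimulation clauses. *)
Lemma crisp_le (b : bool) v : 0 < v -> v <= b%:R -> b.
Proof. by case: b => //= v0 /(lt_le_trans v0); rewrite ltxx. Qed.

(** If, say, [p < q], the implication from [q] to [p] takes the value [p], which lies below [q] and
    hence below 1. *)
Lemma giff_eq1 p q : p <= 1 -> q <= 1 -> 1 <= giff p q -> p = q.
Proof.
move=> p1 q1; rewrite le_min /gimp.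
have [pq|qp|->] // := ltgtP p q; rewrite lexx ?andbT /=.
  by rewrite leNgt (lt_le_trans pq q1).
by rewrite leNgt (lt_le_trans qp p1).
Qed.

End UnitInterval.

Arguments unit_interval : clear implicits.

(** * The value sets lie in [0, 1] *)

Section ValueSetBounds.
Variables (R : realType) (D : Type).
Variables (f g : D -> D -> R) (c : D -> R).
Hypothesis f01 : forall x y, 0 <= f x y <= 1.
Hypothesis g01 : forall x y, 0 <= g x y <= 1.
Hypothesis c01 : forall x, 0 <= c x <= 1.

Lemma comp_values_unit x y : comp_values f g x y `<=` unit_interval R.
Proof. by move=> _ [z _ <-]; apply: min_unit. Qed.

Lemma star_values_unit x y : star_values f x y `<=` unit_interval R.
Proof.
move=> _ [n [s [_ _ ->]]]; apply: gand_unit => i.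
by have /andP[] := f01 (s i) (s i.+1).
Qed.

Lemma ex_values_unit x : ex_values f c x `<=` unit_interval R.
Proof. by move=> _ [y _ <-]; apply: min_unit. Qed.

Lemma all_values_unit x : all_values f c x `<=` unit_interval R.
Proof. by move=> _ [y _ <-]; apply: gimp_unit. Qed.

Lemma atleast_values_unit n x : atleast_values n f c x `<=` unit_interval R.
Proof.
move=> _ [y _ <-]; apply: gand_unit => i.
by have /andP[] := min_unit (f01 x (y i)) (c01 (y i)).
Qed.

Lemma lessthan_values_unit n x : lessthan_values n f c x `<=` unit_interval R.
Proof. by move=> _ [y _ <-]; apply/gimp_unit/bool_unit. Qed.

Lemma all_values_neq0 x : all_values f c x !=set0.
Proof. by exists (gimp (f x x) (c x)); exists x. Qed.

Lemma lessthan_values_neq0 n x : lessthan_values n f c x !=set0.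
Proof. by eexists; exists (fun=> x). Qed.

End ValueSetBounds.

(** * Value sets of converse relations *)

Lemma comp_values_flip (R : realType) (D : Type) (f g : D -> D -> R) x y :
  comp_values f g y x
    = comp_values (fun u v => g v u) (fun u v => f v u) x y.
Proof.
by apply/seteqP; split=> _ [z _ <-]; exists z => //; rewrite minC.
Qed.

(** Paths are read backwards. One inclusion, proved for an arbitrary relation, yields the other when
    applied to the converse relation. *)
Lemma star_values_flip (R : realType) (D : Type) (f : D -> D -> R) x y :
  star_values f y x = star_values (fun u v => f v u) x y.
Proof.
have sub (h : D -> D -> R) u w :
    star_values h w u `<=` star_values (fun u v => h v u) u w.
  move=> _ [n [s [s0 sn ->]]]; exists n, (fun i => s (n - i)%N).
  rewrite subn0 subnn; split=> //; apply/le_anti.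
  (* Step [i] of the reversed path is step [n - i.+1] of the original one, so [rev_ord] matches the
     terms in both directions. *)
  rewrite !gand_le_gand // => i; exists (rev_ord i) => /=; last
    by rewrite subnSK.
  by rewrite subKn // subnSK // subKn // ltnW.
apply/seteqP; split; first exact: sub.
exact: (sub (fun u v => f v u)).
Qed.

(** * Transfer of truth values through each constructor *)

Section Simulation.
Variables (R : realType) (D D' : Type) (Z : D -> D' -> bool).

(* [v] ranges over the positive lower bounds of [f x y]: this is
   [f x y <= f' x' y'] whenever [0 < f x y], in a form stable under minima. *)
Definition simulates (f : D -> D -> R) (f' : D' -> D' -> R) : Prop :=
  forall (v : R) x x' y, 0 < v -> Z x x' -> v <= f x y ->
    exists2 y', Z y y' & v <= f' x' y'.

(** The tuple [y'] is not asked to be related to [y] by [Z]: the clause for unqualified restrictions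
    provides no such link. With constant fillers 1 the same notion therefore serves both kinds of
    restriction. *)
Definition number_transfer n (f : D -> D -> R) (c : D -> R) x
    (f' : D' -> D' -> R) (c' : D' -> R) x' : Prop :=
  forall (y : 'I_n -> D) (v : R), injective y -> 0 < v ->
    (forall i, v <= gand (f x (y i)) (c (y i))) ->
    exists2 y' : 'I_n -> D', injective y' &
      forall i, v <= gand (f' x' (y' i)) (c' (y' i)).

Variables (f g : D -> D -> R) (f' g' : D' -> D' -> R).
Variables (c : D -> R) (c' : D' -> R).
Hypothesis f01 : forall x y, 0 <= f x y <= 1.
Hypothesis f'01 : forall x y, 0 <= f' x y <= 1.
Hypothesis g'01 : forall x y, 0 <= g' x y <= 1.
Hypothesis c01 : forall x, 0 <= c x <= 1.
Hypothesis c'01 : forall x, 0 <= c' x <= 1.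

Lemma simulates_comp :
  (forall x y, sup_witnessed (comp_values f g x y)) ->
  simulates f f' -> simulates g g' ->
  simulates (fun x y => sup (comp_values f g x y))
            (fun x y => sup (comp_values f' g' x y)).
Proof.
move=> wit ff gg v x x' y v0 xx' vle.
(* As [v] is positive, so is the supremum, and it is attained at some [z]. On the target side a mere
   member of the value set is enough, since it bounds the supremum from below. *)
have [z _ Ez] := sup_witnessed_attained (wit x y) (lt_le_trans v0 vle).
move: vle; rewrite -Ez le_min => /andP[vf vg].
have [z' zz' vf'] := ff _ _ _ _ v0 xx' vf.
have [y' yy' vg'] := gg _ _ _ _ v0 zz' vg.
exists y' => //; apply: (@le_trans _ _ (gand (f' x' z') (g' z' y'))).
  by rewrite le_min vf'.
by apply: le_sup_unit; [exact: comp_values_unit | exists z'].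
Qed.

Lemma simulates_path (v : R) n (s : nat -> D) x' :
  simulates f f' -> 0 < v -> Z (s 0%N) x' ->
  (forall i, (i < n)%N -> v <= f (s i) (s i.+1)) ->
  exists s' : nat -> D', [/\ s' 0%N = x', Z (s n) (s' n) &
    forall i, (i < n)%N -> v <= f' (s' i) (s' i.+1)].
Proof.
move=> ff v0 sx'; elim: n => [|n IHn] vf; first by exists (fun=> x').
have [i ltin|s' [s'0 ss' vf']] := IHn; first by apply: vf; apply: ltnW.
have [y' yy' vy'] := ff _ _ _ _ v0 ss' (vf n (ltnSn n)).
(* The path built so far is kept up to index [n] and continued by [y']; values after [n.+1] are
   immaterial. *)
exists (fun i => if (i <= n)%N then s' i else y'); rewrite ltnn; split=> // i.
rewrite ltnS leq_eqVlt => /predU1P[->|ltin] /=; first by rewrite eqxx ltnn.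
by rewrite ltin orbT; apply: vf'.
Qed.

Lemma simulates_star :
  (forall x y, sup_witnessed (star_values f x y)) ->
  simulates f f' ->
  simulates (fun x y => sup (star_values f x y))
            (fun x y => sup (star_values f' x y)).
Proof.
move=> wit ff v x x' y v0 xx' vle.
have [n [s [s0 sn Es]]] :=
  sup_witnessed_attained (wit x y) (lt_le_trans v0 vle).
move: vle; rewrite Es => /le_gandP[v1 vf].
have sx' : Z (s 0%N) x' by rewrite s0.
have [i ltin|s' [s'0 ss' vf']] := simulates_path (n := n) ff v0 sx'.
  exact: (vf (Ordinal ltin)).
exists (s' n); first by rewrite -sn.
apply: (@le_trans _ _ (\gand_(i < n) f' (s' i) (s' i.+1))).
  by apply/le_gandP; split=> // i; apply: vf'.
by apply: le_sup_unit; [exact: star_values_unit | exists n, s'].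
Qed.

Lemma simulates_max :
  simulates f f' -> simulates g g' ->
  simulates (fun x y => gor (f x y) (g x y)) (fun x y => gor (f' x y) (g' x y)).
Proof.
move=> ff gg v x x' y v0 xx'; rewrite le_max => /orP[/ff|/gg] /(_ _ v0 xx') [].
  by move=> y' yy' vf'; exists y' => //; rewrite le_max vf'.
by move=> y' yy' vg'; exists y' => //; rewrite le_max vg' orbT.
Qed.

Lemma simulates_test :
  (forall x x', Z x x' -> c x = c' x') ->
  simulates (fun x y => if `[< x = y >] then c x else 0)
            (fun x y => if `[< x = y >] then c' x else 0).
Proof.
move=> cc v x x' y v0 xx'; case: asboolP => [<- vc|_ /(lt_le_trans v0)].
  by exists x' => //; rewrite asboolT // -(cc _ _ xx').
by rewrite ltxx.
Qed.

(** Each member of the left set is bounded separately. A positive one serves itself as the lower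
    bound [v] to be simulated; any other is below a supremum taken in [0, 1]. *)
Lemma sup_ex_values_le x x' :
  simulates f f' -> (forall x x', Z x x' -> c x = c' x') -> Z x x' ->
  sup (ex_values f c x) <= sup (ex_values f' c' x').
Proof.
move=> ff cc xx'; apply: ge_sup; first by eexists; exists x.
have E01 := ex_values_unit f'01 c'01 (x := x').
move=> _ [y _ <-]; set v := gand _ _; have [v0|v0] := leP v 0.
  by apply: (le_trans v0); have /andP[] := sup_unit E01.
have : v <= v by []; rewrite {2}/v le_min => /andP[vf vc].
have [y' yy' vf'] := ff _ _ _ _ v0 xx' vf.
apply: (@le_trans _ _ (gand (f' x' y') (c' y'))).
  by rewrite le_min vf' -(cc _ _ yy').
by apply: le_sup_unit => //; exists y'.
Qed.

(** An implication of value 1 is above any infimum in [0, 1]. Otherwise [f x y] exceeds [c y], so it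
    is positive and can be simulated with [v := f x y]; the degree found on the other side still
    exceeds the filler, and the implication there takes the same value [c y]. *)
Lemma inf_all_values_le x x' :
  simulates f f' -> (forall x x', Z x x' -> c x = c' x') -> Z x x' ->
  inf (all_values f' c' x') <= inf (all_values f c x).
Proof.
move=> ff cc xx'; apply: lb_le_inf; first exact: all_values_neq0.
have E01 := all_values_unit (f := f') c'01 (x := x').
move=> _ [y _ <-]; rewrite [gimp (f x y) _]/gimp.
have [_|cf] := leP (f x y) (c y).
  by have /andP[] := inf_unit (all_values_neq0 f' c' x') E01.
have f0 : 0 < f x y by have /andP[/le_lt_trans-> //] := c01 y.
have [y' yy' ff'] := ff _ _ _ _ f0 xx' (lexx _).
apply: ge_inf_unit => //; exists y' => //.
by rewrite /gimp -(cc _ _ yy') leNgt (lt_le_trans cf ff').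
Qed.

Lemma sup_atleast_values_le n x x' :
  number_transfer n f c x f' c' x' ->
  sup (atleast_values n f c x) <= sup (atleast_values n f' c' x').
Proof.
move=> tr; have E01 := atleast_values_unit f'01 c'01 (n := n) (x := x').
have /andP[sup0' _] := sup_unit E01.
(* The set is empty when there are fewer than [n] elements; its supremum is then 0. *)
have [->|/set0P E0] := eqVneq (atleast_values n f c x) set0.
  by rewrite sup0.
apply: ge_sup => // _ [y yI <-]; set v := \gand_(i < n) _.
have [/le_trans->//|v0] := leP v 0.
have /le_gandP[v1 vy] := lexx v.
have [y' y'I vy'] := tr _ _ yI v0 vy.
apply: (@le_trans _ _ (\gand_(i < n) gand (f' x' (y' i)) (c' (y' i)))).
  exact/le_gandP.
by apply: le_sup_unit => //; exists y'.
Qed.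

Lemma inf_lessthan_values_le n x x' :
  number_transfer n f c x f' c' x' ->
  inf (lessthan_values n f' c' x') <= inf (lessthan_values n f c x).
Proof.
move=> tr; apply: lb_le_inf; first exact: lessthan_values_neq0.
have E01 := lessthan_values_unit (f := f') (c := c') (n := n) (x := x').
have /andP[_ inf1] := inf_unit (lessthan_values_neq0 f' c' n x') E01.
(* A repeated entry makes the consequent, hence the implication, equal to 1. *)
move=> _ [y _ <-]; case: asboolP => [_|yI].
  by rewrite /gimp if_same.
(* With distinct entries the implication is 1 or 0, and it is 0 exactly when [v] is positive; the
   transferred tuple then gives 0 as well. *)
set v := \gand_(i < n) _; rewrite [gimp v 0]/gimp.
have [//|v0] := leP v 0.
have {}yI : injective y.
  move=> j k yjk; apply/eqP/contraT; rewrite -val_eqE neq_ltn.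
  by case/orP=> ltjk; case: yI; [exists j, k | exists k, j].
have /le_gandP[v1 vy] := lexx v.
have [y' y'I vy'] := tr _ _ yI v0 vy.
apply: ge_inf_unit => //; exists y' => //.
rewrite asboolF; last by case=> j [k [ltjk /y'I Ejk]]; rewrite Ejk ltnn in ltjk.
rewrite /gimp leNgt (lt_le_trans v0) //; exact/le_gandP.
Qed.

End Simulation.

(** * Truth values of roles and concepts, and symmetry of bisimulation *)

Section Semantics.
Variables (R : realType) (CN RN IN : Type) (Phi : set feature).

Scheme role_concept_ind := Induction for role Sort Prop
  with concept_role_ind := Induction for concept Sort Prop.
Combined Scheme role_concept_mutind from role_concept_ind, concept_role_ind.

Lemma bsem_unit (I : interp R CN RN IN) (B : basic_role RN Phi) (x y : I) :
  0 <= bsem B x y <= 1.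
Proof. by case: B => [r|h r]; apply: rname01. Qed.

Lemma sem_unit (I : interp R CN RN IN) :
  (forall (T : role R CN RN IN Phi) (x y : I), 0 <= rsem T x y <= 1) /\
  (forall (C : concept R CN RN IN Phi) (x : I), 0 <= csem C x <= 1).
Proof.
have one01 (y : I) : 0 <= (1 : R) <= 1 by rewrite ler01 lexx.
apply: role_concept_mutind => /=.
- by move=> r x y; apply: rname01.
- by move=> T1 T1u T2 T2u x y; apply/sup_unit/comp_values_unit.
- by move=> T1 T1u T2 T2u x y; apply: max_unit.
- by move=> T1 T1u x y; apply/sup_unit/star_values_unit.
- by move=> C Cu x y; case: asboolP => //; rewrite lexx ler01.
- by move=> h T Tu x y.
- by move=> h x y; apply: one01.
- by move=> p p01.
- by move=> A x; apply: cname01.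
- by move=> C Cu E Eu x; apply: min_unit.
- by move=> C Cu E Eu x; apply: gimp_unit.
- by move=> C Cu x; apply: bool_unit.
- by move=> C Cu E Eu x; apply: max_unit.
- by move=> C Cu x; have /andP[c0 c1] := Cu x; rewrite subr_ge0 c1 gerBl.
- move=> T Tu C Cu x; apply: inf_unit; first exact: all_values_neq0.
  exact: all_values_unit.
- by move=> T Tu C Cu x; apply/sup_unit/ex_values_unit.
- by move=> h a x; apply: bool_unit.
- by move=> h r x; apply: rname01.
- move=> n h B C Cu x; apply/sup_unit/atleast_values_unit => // *.
  exact: bsem_unit.
- move=> n h B C Cu x; apply: inf_unit; first exact: lessthan_values_neq0.
  exact: lessthan_values_unit.
- move=> n h B x; apply/sup_unit/atleast_values_unit => // *.
  exact: bsem_unit.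
- move=> n h B x; apply: inf_unit; first exact: lessthan_values_neq0.
  exact: lessthan_values_unit.
Qed.

Lemma rsem_unit (I : interp R CN RN IN) (T : role R CN RN IN Phi) (x y : I) :
  0 <= rsem T x y <= 1.
Proof. exact: (sem_unit I).1. Qed.

Lemma csem_unit (I : interp R CN RN IN) (C : concept R CN RN IN Phi) (x : I) :
  0 <= csem C x <= 1.
Proof. exact: (sem_unit I).2. Qed.

(** The forth and back clauses trade places; the remaining ones are symmetric in the two sides. *)
Lemma crisp_bisimulation_sym (I I' : interp R CN RN IN) (Z : I -> I' -> bool) :
  crisp_bisimulation Phi Z -> crisp_bisimulation Phi (fun x' x => Z x x').
Proof.
have giffC (p q : R) : giff p q = giff q p by rewrite /giff minC.
case=> cn fo ba no uf ub se qf qb nf nb; split.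
- by move=> x' x A; rewrite giffC.
- by move=> x' x; apply: ba.
- by move=> x' x; apply: fo.
- by move=> h x' x a H; apply: (no h x x' a); tauto.
- by move=> h x' x; apply: ub.
- by move=> h x' x; apply: uf.
- by move=> h x' x r; rewrite giffC; apply: se.
- by move=> n h x' x; apply: qb.
- by move=> n h x' x; apply: qf.
- by move=> n h x' x; apply: nb.
- by move=> n h x' x; apply: nf.
Qed.

(** * Basic roles and number restrictions along a bisimulation *)

Section CrispBisimulation.
Variables (I I' : interp R CN RN IN) (Z : I -> I' -> bool).
Hypothesis bisZ : crisp_bisimulation Phi Z.

Lemma simulates_bsem (B : basic_role RN Phi) : simulates Z (bsem B) (bsem B).
Proof.
move=> v x x' y v0 xx' vB; have [y' le_y'] := bisim_forth bisZ x x' B y.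
have : v <= gand (Z x x')%:R (bsem B x y).
  by rewrite le_min vB xx' (le_trans vB) //; have /andP[] := bsem_unit B x y.
move=> /le_trans/(_ le_y'); rewrite le_min => /andP[/(crisp_le v0) yy' vB'].
by exists y'.
Qed.

(** The index [j] paired with [i] need not depend injectively on [i]. This is harmless: [v] bounds
    the filler at every [y j], and distinctness of the [y' i] is part of the clause. *)
Lemma bisim_number_transfer n (B : basic_role RN Phi) (c : I -> R)
    (c' : I' -> R) (x : I) (x' : I') :
  Phi (FQ n) -> Z x x' -> (forall y, c y <= 1) ->
  (forall y y', Z y y' -> c y = c' y') ->
  number_transfer n (bsem B) c x (bsem B) c' x'.
Proof.
move=> h xx' c1 cc y v yI v0 vy.
have vB i : v <= bsem B x (y i) by have := vy i; rewrite le_min => /andP[].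
have vc i : v <= c (y i) by have := vy i; rewrite le_min => /andP[].
have [|j|y' y'I y'P] := bisim_Q_forth bisZ h (x := x) (x' := x') (B := B) _ yI.
- by rewrite xx' ltr01.
- exact: lt_le_trans (vB j).
exists y' => // i; have [j /(le_trans _) yj] := y'P i.
have v1 : v <= 1 := le_trans (vc j) (c1 _).
have : v <= gand (Z (y j) (y' i))%:R (bsem B x' (y' i)).
  by apply: yj; rewrite le_min xx' v1 /=; apply/le_gandP.
rewrite le_min => /andP[/(crisp_le v0) yy' vB'].
by rewrite le_min vB' -(cc _ _ yy') vc.
Qed.

Lemma bisim_number_transferU n (B : basic_role RN Phi) (x : I) (x' : I') :
  Phi (FN n) -> Z x x' ->
  number_transfer n (bsem B) (fun=> 1) x (bsem B) (fun=> 1) x'.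
Proof.
move=> h xx' y v yI v0 vy.
have vB i : v <= bsem B x (y i) by have := vy i; rewrite le_min => /andP[].
(* The bound comes from the filler 1 of an entry, so it is available only once an index is given. *)
have v1 (i : 'I_n) : v <= 1 by have := vy i; rewrite le_min => /andP[].
have [|j|y' y'I y'P] := bisim_N_forth bisZ h (x := x) (x' := x') (B := B) _ yI.
- by rewrite xx' ltr01.
- exact: lt_le_trans (vB j).
exists y' => // i; rewrite le_min (v1 i) andbT; apply: le_trans (y'P i).
by rewrite le_min xx' (v1 i) /=; apply/le_gandP; split=> //; apply: v1.
Qed.

End CrispBisimulation.

(** * The mutual induction on roles and concepts *)

Definition bisim_simulates (T : role R CN RN IN Phi) : Prop :=
  forall (I I' : interp R CN RN IN) (Z : I -> I' -> bool),
    witnessed Phi I -> witnessed Phi I' -> crisp_bisimulation Phi Z ->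
    simulates Z (rsem T) (rsem T) /\
    (Phi FI -> simulates Z (fun x y => rsem T y x) (fun x y => rsem T y x)).

(** Here as in [bisim_simulates], the interpretations and [Z] are quantified inside, so that
    induction hypotheses also apply to the converse bisimulation. *)
Definition bisim_invariant (C : concept R CN RN IN Phi) : Prop :=
  forall (I I' : interp R CN RN IN) (Z : I -> I' -> bool),
    witnessed Phi I -> witnessed Phi I' -> crisp_bisimulation Phi Z ->
    forall x x', Z x x' -> csem C x = csem C x'.

Lemma bisim_invariant_le (C : concept R CN RN IN Phi) :
  (forall (I I' : interp R CN RN IN) (Z : I -> I' -> bool),
    witnessed Phi I -> witnessed Phi I' -> crisp_bisimulation Phi Z ->
    forall x x', Z x x' -> csem C x <= csem C x') ->
  bisim_invariant C.
Proof.
move=> le_C I I' Z wI wI' bZ x x' xx'; apply/le_anti.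
rewrite (le_C _ _ _ wI wI' bZ) //.
by rewrite (le_C _ _ _ wI' wI (crisp_bisimulation_sym bZ)).
Qed.

Lemma bisim_sem :
  (forall T, bisim_simulates T) /\ (forall C, bisim_invariant C).
Proof.
apply: role_concept_mutind => /=.
- move=> r I I' Z wI wI' bZ; split=> [|h].
    by move=> v x x' y; apply: (simulates_bsem bZ (B := BName Phi r)).
  (* The converse of a role name is a basic role, thanks to [h]. *)
  by move=> v x x' y; apply: (simulates_bsem bZ (B := BInv h r)).
- move=> T1 IH1 T2 IH2 I I' Z wI wI' bZ.
  have [[s1 i1] [s2 i2]] := (IH1 _ _ _ wI wI' bZ, IH2 _ _ _ wI wI' bZ).
  split=> [|h] /=.
    apply: simulates_comp => //; do ?by move=> *; apply: rsem_unit.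
    exact: wit_comp wI _ _.
  (* The converse of a composition composes the converses in the opposite order, so [i2] is used
     before [i1]. *)
  have flipE (J : interp R CN RN IN) :
      (fun x y : J => sup (comp_values (rsem T1) (rsem T2) y x)) =
      (fun x y => sup (comp_values (fun u v => rsem T2 v u)
                                   (fun u v => rsem T1 v u) x y)).
    by apply/funext => x; apply/funext => y; rewrite comp_values_flip.
  rewrite !flipE.
  apply: simulates_comp; do ?by move=> *; apply: rsem_unit.
  (* Flipping back turns the set into one of [T1] and [T2] themselves, to which witnessedness
     applies. *)
  + by move=> x y; rewrite -comp_values_flip; apply: wit_comp.
  + exact: i2.
  + exact: i1.
- move=> T1 IH1 T2 IH2 I I' Z wI wI' bZ.
  have [[s1 i1] [s2 i2]] := (IH1 _ _ _ wI wI' bZ, IH2 _ _ _ wI wI' bZ).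
  by split=> [|h]; apply: simulates_max; do ?by [|apply: i1|apply: i2].
- move=> T IH I I' Z wI wI' bZ; have [s i] := IH _ _ _ wI wI' bZ.
  split=> [|h].
    apply: simulates_star => //; do ?by move=> *; apply: rsem_unit.
    exact: wit_star wI _.
  have flipE (J : interp R CN RN IN) :
      (fun x y : J => sup (star_values (rsem T) y x)) =
      (fun x y => sup (star_values (fun u v => rsem T v u) x y)).
    by apply/funext => x; apply/funext => y; rewrite star_values_flip.
  rewrite /= !flipE.
  apply: simulates_star; do ?by move=> *; apply: rsem_unit.
  + by move=> x y; rewrite -star_values_flip; apply: wit_star.
  + exact: i.
- move=> C IH I I' Z wI wI' bZ.
  have st := simulates_test (IH _ _ _ wI wI' bZ); split=> // h /=.
  move=> v x x' y v0 xx'; case: asboolP => [-> vc|_ /(lt_le_trans v0)].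
    by exists x' => //; rewrite asboolT // -(IH _ _ _ wI wI' bZ _ _ xx').
  by rewrite ltxx.
- move=> h T IH I I' Z wI wI' bZ; have [s i] := IH _ _ _ wI wI' bZ.
  (* Inversion swaps the two halves of the induction hypothesis. *)
  by split=> [|_]; [exact: (i h) | exact: s].
- move=> h I I' Z wI wI' bZ.
  (* The universal role is its own converse, so one simulation settles both halves. *)
  suff s : simulates Z (fun=> fun=> 1 : R) (fun=> fun=> 1).
    by split.
  move=> v x x' y v0 xx' v1; have [y' yy'] := bisim_univ_forth bZ h x x' y.
  by exists y' => //; rewrite xx' in yy'; apply: (crisp_le ltr01 yy').
- by [].
- move=> A I I' Z wI wI' bZ x x' xx'.
  have /andP[_ a1] := cname01 A x; have /andP[_ a1'] := cname01 A x'.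
  by apply: giff_eq1 => //; have := bisim_cname bZ x x' A; rewrite xx'.
- move=> C IC E IE I I' Z wI wI' bZ x x' xx' /=.
  by rewrite (IC _ _ _ wI wI' bZ _ _ xx') (IE _ _ _ wI wI' bZ _ _ xx').
- move=> C IC E IE I I' Z wI wI' bZ x x' xx' /=.
  by rewrite (IC _ _ _ wI wI' bZ _ _ xx') (IE _ _ _ wI wI' bZ _ _ xx').
- move=> C IC I I' Z wI wI' bZ x x' xx' /=.
  by rewrite (IC _ _ _ wI wI' bZ _ _ xx').
- move=> C IC E IE I I' Z wI wI' bZ x x' xx' /=.
  by rewrite (IC _ _ _ wI wI' bZ _ _ xx') (IE _ _ _ wI wI' bZ _ _ xx').
- move=> C IC I I' Z wI wI' bZ x x' xx' /=.
  by rewrite (IC _ _ _ wI wI' bZ _ _ xx').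
- move=> T IT C IC; apply: bisim_invariant_le => I I' Z wI wI' bZ x x' xx' /=.
  (* Infima are compared from target to source, so the converse bisimulation is the one to run. *)
  have bZ' := crisp_bisimulation_sym bZ.
  apply: inf_all_values_le (IT _ _ _ wI' wI bZ').1 (IC _ _ _ wI' wI bZ') xx';
    by move=> *; apply: csem_unit.
- move=> T IT C IC; apply: bisim_invariant_le => I I' Z wI wI' bZ x x' xx' /=.
  apply: sup_ex_values_le (IT _ _ _ wI wI' bZ).1 (IC _ _ _ wI wI' bZ) xx';
    by move=> *; [apply: rsem_unit || apply: csem_unit].
- move=> h a I I' Z wI wI' bZ x x' xx' /=.
  have no := bisim_nominal bZ h (x := x) (x' := x') (a := a).
  by case: asboolP => xa; case: asboolP => x'a //; rewrite no // in xx'; tauto.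
- move=> h r I I' Z wI wI' bZ x x' xx' /=.
  have /andP[_ a1] := rname01 r x x; have /andP[_ a1'] := rname01 r x' x'.
  by apply: giff_eq1 => //; have := bisim_self bZ h x x' r; rewrite xx'.
- move=> n h B C IC; apply: bisim_invariant_le => I I' Z wI wI' bZ x x' xx' /=.
  apply: sup_atleast_values_le; do ?by move=> *; apply: bsem_unit.
    by move=> *; apply: csem_unit.
  apply: (bisim_number_transfer bZ h xx' _ (IC _ _ _ wI wI' bZ)) => y.
  by have /andP[] := csem_unit C y.
- move=> n h B C IC; apply: bisim_invariant_le => I I' Z wI wI' bZ x x' xx' /=.
  have bZ' := crisp_bisimulation_sym bZ.
  apply: inf_lessthan_values_le.
  apply: (bisim_number_transfer bZ' h xx' _ (IC _ _ _ wI' wI bZ')) => y.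
  by have /andP[] := csem_unit C y.
- move=> n h B; apply: bisim_invariant_le => I I' Z wI wI' bZ x x' xx' /=.
  apply: sup_atleast_values_le; do ?by move=> *; apply: bsem_unit.
    by move=> *; rewrite ler01 lexx.
  exact (bisim_number_transferU bZ (B := B) h xx').
- move=> n h B; apply: bisim_invariant_le => I I' Z wI wI' bZ x x' xx' /=.
  apply: inf_lessthan_values_le.
  exact (bisim_number_transferU (crisp_bisimulation_sym bZ) (B := B) h xx').
Qed.

End Semantics.

Theorem theorem5 (R : realType) (CN RN IN : Type) (Phi : set feature)
  (Phi_sub : Phi `<=` features)
  (I I' : interp R CN RN IN)
  (witI : witnessed Phi I) (witI' : witnessed Phi I')
  (x : I) (x' : I') (bisim : strongly_bisimilar Phi x x')
  (C : concept R CN RN IN Phi) :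
  csem C x = csem C x'.
Proof.
have [Z bisZ xx'] := bisim.
exact: (bisim_sem R CN RN IN Phi).2 witI witI' bisZ _ _ xx'.
Qed.
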